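(* Let $k=k(x)$ be a continuous real function on $\mathbb R^3$. Then: iii) if $\inf_{\mathbb R^3}k>0$ or $\sup_{\mathbb R^3}k<0$, the equation $\mathsf L(u;k)=0$ has no locally Lipschitz weak solution on $\mathbb R^3$; iv) if $k$ is constant, the equation $\mathsf L(u;k)=0$ has weak solutions in $\mathrm{Lip}_{\mathrm{loc}}(\mathbb R^3)$ if and only if $k\equiv0$.
   Context: For a function $v$ of $x=(x_1,x_2,x_3)$ write $v_i=\partial v/\partial x_i$, $v_{ij}=\partial^2v/\partial x_i\partial x_j$, $Dv=(v_1,v_2,v_3)$. The complete Levi operator for graphs is $$\mathsf L(v;k)=(1+v_3^2)(v_{11}+v_{22})+(v_1^2+v_2^2)v_{33}+2(v_2-v_1v_3)v_{13}-2(v_1+v_2v_3)v_{23}+k\,(1+|Dv|^2)^{3/2}.$$ A continuous $v$ is a weak subsolution (supersolution) of $\mathsf L(v;k)=0$ if for every point $y$ of the domain and every $C^\infty$ function $\phi$ such that $v-\phi$ has a local maximum (minimum) at $y$ one has $\mathsf L(\phi;k)(y)\ge0$ ($\le0$); it is a weak solution if it is both. $\mathrm{Lip}_{\mathrm{loc}}(\mathbb R^3)$ is the space of locally Lipschitz functions on $\mathbb R^3$. *)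

(* Defs.v *)
From mathcomp Require Import all_boot all_order all_algebra.
From mathcomp Require Import all_classical all_reals all_analysis.

Set Implicit Arguments.
Unset Strict Implicit.
Unset Printing Implicit Defensive.

Import Order.TTheory GRing.Theory Num.Theory.
Import numFieldNormedType.Exports.

Local Open Scope classical_set_scope.
Local Open Scope ring_scope.

(** Functions on [R^3] are functions on row vectors ['rV[R]_3]. The library
    puts the sup norm there, which defines the same topology and the same
    locally Lipschitz functions as the Euclidean norm. *)

Definition partial (R : realType) (i : 'I_3) (f : 'rV[R]_3 -> R) :
  'rV[R]_3 -> R := 'D_(delta_mx 0 i) f.

Definition iter_partial (R : realType) (s : seq 'I_3) (f : 'rV[R]_3 -> R) :
  'rV[R]_3 -> R := foldr (@partial R) f s.

(** [derive] is a total operation, so differentiability at each stage is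
    required separately from continuity. *)
Definition smooth (R : realType) (f : 'rV[R]_3 -> R) : Prop :=
  forall s : seq 'I_3,
    continuous (iter_partial s f) /\
    (forall (i : 'I_3) (x : 'rV[R]_3),
       derivable (iter_partial s f) x (delta_mx 0 i)).

Definition i1 : 'I_3 := @Ordinal 3 0 isT.
Definition i2 : 'I_3 := @Ordinal 3 1 isT.
Definition i3 : 'I_3 := @Ordinal 3 2 isT.

Definition levi (R : realType) (v k : 'rV[R]_3 -> R) (x : 'rV[R]_3) : R :=
  let v1 := partial i1 v x in
  let v2 := partial i2 v x in
  let v3 := partial i3 v x in
  let v11 := partial i1 (partial i1 v) x in
  let v22 := partial i2 (partial i2 v) x in
  let v33 := partial i3 (partial i3 v) x in
  let v13 := partial i1 (partial i3 v) x in
  let v23 := partial i2 (partial i3 v) x in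
  (1 + v3 ^+ 2) * (v11 + v22) + (v1 ^+ 2 + v2 ^+ 2) * v33
  + 2 * (v2 - v1 * v3) * v13 - 2 * (v1 + v2 * v3) * v23
  + k x * (1 + (v1 ^+ 2 + v2 ^+ 2 + v3 ^+ 2)) `^ (3 / 2).

Definition local_max (R : realType) (f : 'rV[R]_3 -> R) (y : 'rV[R]_3) : Prop :=
  \forall z \near y, f z <= f y.

Definition local_min (R : realType) (f : 'rV[R]_3 -> R) (y : 'rV[R]_3) : Prop :=
  \forall z \near y, f y <= f z.

Definition weak_subsolution (R : realType) (v k : 'rV[R]_3 -> R) : Prop :=
  continuous v /\
  forall (y : 'rV[R]_3) (phi : 'rV[R]_3 -> R), smooth phi ->
    local_max (fun z => v z - phi z) y -> 0 <= levi phi k y.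

Definition weak_supersolution (R : realType) (v k : 'rV[R]_3 -> R) : Prop :=
  continuous v /\
  forall (y : 'rV[R]_3) (phi : 'rV[R]_3 -> R), smooth phi ->
    local_min (fun z => v z - phi z) y -> levi phi k y <= 0.

Definition weak_solution (R : realType) (v k : 'rV[R]_3 -> R) : Prop :=
  weak_subsolution v k /\ weak_supersolution v k.

Definition locally_lipschitz (R : realType) (u : 'rV[R]_3 -> R) : Prop :=
  forall x : 'rV[R]_3, exists2 U, nbhs x U & [lipschitz u z | z in U].

(* Main.v *)
Require Import Defs.
From mathcomp Require Import all_boot all_order all_algebra.
From mathcomp Require Import all_classical all_reals all_analysis.
From mathcomp Require Import ring lra.
Import Order.TTheory GRing.Theory Num.Theory.
Import numFieldNormedType.Exports.
Local Open Scope classical_set_scope.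
Local Open Scope ring_scope.

(** The equation prescribes the curvature [k] of the graph of [u] with respect
to the complex tangent directions, and on a sphere of radius [r] this curvature
is a constant of order [1 / r]: the function [s = sqrt (r^2 - |x|^2)] satisfies
[L(s; 0) = - 2 r^2 / s^3 = - (2 / r) (1 + |Ds|^2)^(3/2)].

Suppose [k >= c > 0]. On the closed ball of radius [r] the function [u - s]
attains its minimum ([hemisphere_min]). The minimum is not on the boundary:
there the slope of [s] is infinite, whereas [u] is Lipschitz near each point
([hemisphere_min_interior]). At an interior minimum [y] the hemisphere is an
admissible test function from below, and the supersolution inequality bounds
[k y] by a multiple of [1 / r]. For [r] large this contradicts [k y >= c].

If [k <= - c < 0], the same comparison with [- s] from above applies. The sign
[e = 1] or [e = -1] treats both cases at once ([no_entire_solution]): the part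
of [L(v; 0)] that is quadratic in [v] cancels on spheres, so that [L(- s; 0)]
is [- L(s; 0)].

Test functions must be smooth on the whole space, which [s] is not. It is
replaced near [y] by the polynomial [cap], which lies below [s] and
touches it at [y]. The price is that the constant [2 / r] becomes at most [5 / r].
Polynomials are handled through a syntax with formal derivatives, so that the
Levi operator on them is found by computation ([levi_cap]).

For [k = 0] the zero function is a solution, by the first and second derivative
tests along the coordinate axes ([partial_at_local_min]). A nonzero constant
[k] falls under the two cases above. *)

(** * Polynomial functions of three variables *)

(** Syntactic polynomials: being closed under formal partial derivatives, they
make smoothness in the sense of iterated partial derivatives immediate. *)
Inductive poly3 (R : realType) : Type :=
| PCst of R
| PVar of 'I_3
| PAdd of poly3 R & poly3 R
| PMul of poly3 R & poly3 R.

Arguments PCst {R} c.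
Arguments PVar {R} i.
Arguments PAdd {R} p q.
Arguments PMul {R} p q.

Fixpoint peval {R : realType} (p : poly3 R) (x : 'rV[R]_3) : R :=
  match p with
  | PCst c => c
  | PVar i => x 0 i
  | PAdd p q => peval p x + peval q x
  | PMul p q => peval p x * peval q x
  end.

Fixpoint pder {R : realType} (i : 'I_3) (p : poly3 R) : poly3 R :=
  match p with
  | PCst c => PCst 0
  | PVar j => PCst (i == j)%:R
  | PAdd p q => PAdd (pder i p) (pder i q)
  | PMul p q => PAdd (PMul (pder i p) q) (PMul p (pder i q))
  end.

Lemma is_derive_peval {R : realType} (p : poly3 R) (i : 'I_3) (x : 'rV[R]_3) :
  is_derive x (delta_mx 0 i : 'rV[R]_3) (peval p) (peval (pder i p) x).
Proof.
elim: p => [c|j|p IHp q IHq|p IHp q IHq] /=.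
- exact: is_derive_cst.
- have dc : differentiable (fun y : 'rV[R]_3 => y 0 j) x.
    exact: differentiable_coord.
  apply: DeriveDef; first exact: diff_derivable.
  rewrite /derive; apply: lim_near_cst => //.
  near=> h; rewrite /= !mxE eqxx /= addrK.
  have h0 : h != 0 by near: h; exact: nbhs_dnbhs_neq.
  by rewrite (eq_sym i) [LHS]mulKf.
- exact: is_deriveD.
- change (is_derive x (delta_mx 0 i : 'rV[R]_3) (peval p * peval q)
    (peval (pder i p) x * peval q x + peval p x * peval (pder i q) x)).
  apply: is_derive_eq.
  by rewrite /GRing.scale /= addrC [X in X + _]mulrC.
Unshelve. all: by end_near. Qed.

Lemma partial_peval {R : realType} (p : poly3 R) (i : 'I_3) :
  partial i (peval p) = peval (pder i p).
Proof. by apply/funext => x; have [_] := is_derive_peval p i x. Qed.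

Lemma continuous_peval {R : realType} (p : poly3 R) : continuous (peval p).
Proof.
elim: p => [c|j|p IHp q IHq|p IHp q IHq] x /=.
- exact: cst_continuous.
- exact: coord_continuous.
- by apply: (@continuousD _ _ _ (peval p) (peval q)); [exact: IHp|exact: IHq].
- by apply: (@continuousM _ _ (peval p) (peval q)); [exact: IHp|exact: IHq].
Qed.

Lemma smooth_peval {R : realType} (p : poly3 R) : smooth (peval p).
Proof.
move=> s.
have -> : iter_partial s (peval p) = peval (foldr pder p s).
  by elim: s => //= i s ->; rewrite partial_peval.
split; first exact: continuous_peval.
by move=> i x; have [] := is_derive_peval (foldr pder p s) i x.
Qed.

(** * The Euclidean norm *)

Definition normsq {R : realType} (x : 'rV[R]_3) : R :=
  x 0 i1 ^+ 2 + x 0 i2 ^+ 2 + x 0 i3 ^+ 2.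

Definition pnormsq {R : realType} : poly3 R :=
  PAdd (PAdd (PMul (PVar i1) (PVar i1)) (PMul (PVar i2) (PVar i2)))
       (PMul (PVar i3) (PVar i3)).

Lemma continuous_normsq {R : realType} : continuous (@normsq R).
Proof.
have -> : normsq = peval (@pnormsq R).
  by apply/funext => x; rewrite /= /normsq !expr2.
exact: continuous_peval.
Qed.

Lemma normsqZ {R : realType} (a : R) (x : 'rV[R]_3) :
  normsq (a *: x) = a ^+ 2 * normsq x.
Proof. by rewrite /normsq !mxE; ring. Qed.

Lemma norm_le_normsq {R : realType} (r : R) (x : 'rV[R]_3) :
  0 <= r -> normsq x <= r ^+ 2 -> `|x| <= r.
Proof.
move=> r0 xr; rewrite [leLHS]/Num.norm /= mx_normrE; apply/bigmax_leP; split=> // -[i j] _ /=.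
rewrite (ord1 i) -(@ler_pXn2r _ 2)// ?nnegrE// real_normK ?num_real//.
apply: le_trans xr; rewrite /normsq.
have := (sqr_ge0 (x 0 i1), sqr_ge0 (x 0 i2), sqr_ge0 (x 0 i3)).
have : [\/ j = i1, j = i2 | j = i3].
  by case: j => -[|[|[|//]]] jp; [apply: Or31|apply: Or32|apply: Or33];
    exact: val_inj.
by case=> -> [[]]; lra.
Qed.

(** * Polynomial caps below the hemisphere *)

(** Let [s] be the height of the hemisphere over [y]. With [d = |y|^2 - |x|^2]
the hemisphere is [sqrt (s^2 + d)], whose Taylor
polynomial in [d] is [s + d / (2 s) - d^2 / (8 s^3)]. The last coefficient is
increased here to [1 / (2 s^3)], which makes the polynomial a lower bound
wherever the hemisphere is defined; see [cap_le]. *)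
Definition cap {R : realType} (s : R) (y : 'rV[R]_3) : poly3 R :=
  let d := PAdd (PCst (normsq y)) (PMul (PCst (-1)) pnormsq) in
  PAdd (PAdd (PCst s) (PMul (PCst (2 * s)^-1) d))
       (PMul (PCst (- (2 * s ^+ 3)^-1)) (PMul d d)).

Lemma capE {R : realType} (s : R) (y x : 'rV[R]_3) :
  peval (cap s y) x = s + (2 * s)^-1 * (normsq y - normsq x)
                      - (2 * s ^+ 3)^-1 * (normsq y - normsq x) ^+ 2.
Proof. by rewrite /= /normsq; ring. Qed.

(** Here [t] is the height of the hemisphere over [x]. The coefficient chosen for
[d^2] makes [t - cap s y x] equal to [t (t + 2 s) (t - s)^2 / (2 s^3)]. *)
Lemma cap_le {R : realType} (s t : R) (y x : 'rV[R]_3) : 0 < s -> 0 <= t ->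
  s ^+ 2 + normsq y = t ^+ 2 + normsq x -> peval (cap s y) x <= t.
Proof.
move=> s0 t0 E; rewrite capE.
have -> : normsq y - normsq x = t ^+ 2 - s ^+ 2.
  by apply/eqP; rewrite subr_eq addrAC -E addrAC subrr add0r.
rewrite -subr_ge0.
have -> : t - (s + (2 * s)^-1 * (t ^+ 2 - s ^+ 2)
           - (2 * s ^+ 3)^-1 * (t ^+ 2 - s ^+ 2) ^+ 2)
        = t * (t + 2 * s) * (t - s) ^+ 2 / (2 * s ^+ 3).
  by field; rewrite gt_eqF.
have s0' := ltW s0.
apply: divr_ge0; last by apply: mulr_ge0 => //; exact: exprn_ge0.
by apply: mulr_ge0 (sqr_ge0 _); apply: mulr_ge0 => //; lra.
Qed.

(** Up to the factor [e], the cap has at [y] the gradient [- y / s] of the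
hemisphere, and its Hessian is the one of the hemisphere minus
[3 y_i y_j / s^3]. The hemisphere accounts for the term [2 r^2], the difference
of the Hessians for the term [3 (y_1^2 + y_2^2)]. *)
Lemma levi_cap {R : realType} (e s r : R) (y : 'rV[R]_3) (k : 'rV[R]_3 -> R) :
  0 < s -> 0 < r -> e ^+ 2 = 1 -> s ^+ 2 + normsq y = r ^+ 2 ->
  levi (peval (PMul (PCst e) (cap s y))) k y
  = (k y * r ^+ 3 - e * (2 * r ^+ 2 + 3 * (y 0 i1 ^+ 2 + y 0 i2 ^+ 2))) / s ^+ 3.
Proof.
move=> s0 r0 e1 E; rewrite /levi !partial_peval.
set P := PMul _ _.
have sN0 : s != 0 by rewrite gt_eqF.
move: E; rewrite /normsq.
set a := y 0 i1; set b := y 0 i2; set c := y 0 i3 => E.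
have -> : peval (pder i1 P) y = - e * a / s.
  by rewrite /= /normsq -/a -/b -/c; field.
have -> : peval (pder i2 P) y = - e * b / s.
  by rewrite /= /normsq -/a -/b -/c; field.
have -> : peval (pder i3 P) y = - e * c / s.
  by rewrite /= /normsq -/a -/b -/c; field.
have -> : peval (pder i1 (pder i1 P)) y = - e * (s^-1 + 4 * a * a / s ^+ 3).
  by rewrite /= /normsq -/a -/b -/c; field.
have -> : peval (pder i2 (pder i2 P)) y = - e * (s^-1 + 4 * b * b / s ^+ 3).
  by rewrite /= /normsq -/a -/b -/c; field.
have -> : peval (pder i3 (pder i3 P)) y = - e * (s^-1 + 4 * c * c / s ^+ 3).
  by rewrite /= /normsq -/a -/b -/c; field.
have -> : peval (pder i1 (pder i3 P)) y = - e * (4 * a * c / s ^+ 3).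
  by rewrite /= /normsq -/a -/b -/c; field.
have -> : peval (pder i2 (pder i3 P)) y = - e * (4 * b * c / s ^+ 3).
  by rewrite /= /normsq -/a -/b -/c; field.
have -> : 1 + ((- e * a / s) ^+ 2 + (- e * b / s) ^+ 2 + (- e * c / s) ^+ 2)
        = (r / s) ^+ 2.
  rewrite !expr_div_n -E !exprMn sqrrN e1; field.
  exact: sN0.
have rs0 : 0 <= r / s by rewrite divr_ge0 ?ltW.
have -> : ((r / s) ^+ 2) `^ (3 / 2) = (r / s) ^+ 3.
  rewrite -powR_mulrn// -powRrM -powR_mulrn//; congr (_ `^ _); lra.
rewrite -E expr_div_n.
(* The powers of [e] differ from term to term, hence the case distinction. *)
move/eqP: e1; rewrite sqrf_eq1 => /orP[]/eqP ->; field; exact: sN0.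
Qed.

(** * Touching a locally Lipschitz function from below *)

Lemma hemisphere_min {R : realType} (v : 'rV[R]_3 -> R) (r : R) :
  0 < r -> continuous v ->
  exists2 y, normsq y <= r ^+ 2 & forall x, normsq x <= r ^+ 2 ->
    v y - Num.sqrt (r ^+ 2 - normsq y) <= v x - Num.sqrt (r ^+ 2 - normsq x).
Proof.
move=> r0 cv; pose A := [set x : 'rV[R]_3 | normsq x <= r ^+ 2].
have A0 : A !=set0.
  by exists 0; rewrite /A /= /normsq !mxE expr0n /= !addr0 sqr_ge0.
have cA : compact A.
  apply: bounded_closed_compact.
    exists r; split; first exact: num_real.
    move=> M rM x Ax; apply: le_trans (ltW rM).
    by apply: norm_le_normsq => //; exact: ltW.
  apply: (@closed_comp _ _ normsq [set t | t <= r ^+ 2]); last exact: closed_le.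
  by move=> x _; exact: continuous_normsq.
have cf : continuous (fun x => v x - Num.sqrt (r ^+ 2 - normsq x)).
  move=> x; apply: (@continuousB _ _ _ v); first exact: cv.
  apply: (@continuous_comp _ _ _ (fun x => r ^+ 2 - normsq x) Num.sqrt).
    apply: (@continuousB _ _ _ (cst (r ^+ 2)) normsq); first exact: cst_continuous.
    exact: continuous_normsq.
  exact: sqrt_continuous.
have [y] := EVT_min_rV A0 cA (continuous_subspaceT cf).
rewrite inE => Ay miny; exists y => // x Ax; apply: miny.
by rewrite inE.
Qed.

(** Moving from a boundary point [y] radially inwards by the fraction [t] raises
the hemisphere by at least [r sqrt t], but [v] by at most [M t r]; for small [t]
the first is larger, and the value at [y] is not minimal. *)
Lemma hemisphere_min_interior {R : realType} (v : 'rV[R]_3 -> R) (r : R)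
    (y : 'rV[R]_3) :
  0 < r -> locally_lipschitz v -> normsq y <= r ^+ 2 ->
  (forall x, normsq x <= r ^+ 2 ->
    v y - Num.sqrt (r ^+ 2 - normsq y) <= v x - Num.sqrt (r ^+ 2 - normsq x)) ->
  normsq y < r ^+ 2.
Proof.
move=> r0 lv yr miny; rewrite lt_neqAle yr andbT; apply/negP => /eqP yE.
have [U Uy /pinfty_ex_gt0[M M0 lipM]] := lv y.
have : (1 - t) *: y @[t --> (0 : R)] --> y.
  rewrite -[X in _ --> X]scale1r -{2}(subr0 (1 : R)).
  by apply: cvgZr_tmp; apply: cvgB; [exact: cvg_cst|exact: cvg_id].
move=> /(_ _ Uy) Ut.
(* Minimality at [y] gives [r^2 (2 t - t^2) <= (M t r)^2], that is
   [2 - t <= M^2 t], which fails if [t < 1] and [M^2 t < 1]. *)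
have [t [[Uty t0] [t1 tM]]] :
    exists t : R, (U ((1 - t) *: y) /\ 0 < t) /\ (t < 1 /\ M ^+ 2 * t < 1).
  near (0 : R)^'+ => t; exists t; split; split.
  - by near: t; apply: cvg_within; exact: Ut.
  - by near: t; exact: nbhs_right_gt.
  - by near: t; exact: nbhs_right_lt.
  - rewrite -ltr_pdivlMl ?exprn_gt0// mulr1.
    by near: t; apply: nbhs_right_lt; rewrite invr_gt0 exprn_gt0.
have wE : r ^+ 2 - normsq ((1 - t) *: y) = r ^+ 2 * (2 * t - t ^+ 2).
  by rewrite normsqZ yE; ring.
have w0 : 0 <= r ^+ 2 - normsq ((1 - t) *: y).
  rewrite wE mulr_ge0 ?sqr_ge0// (_ : 2 * t - t ^+ 2 = t * (2 - t)); last by ring.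
  by apply: mulr_ge0; lra.
have := miny ((1 - t) *: y); rewrite -subr_ge0 => /(_ w0).
rewrite yE subrr sqrtr0 subr0 => le1.
have le2 : v ((1 - t) *: y) - v y <= M * (t * r).
  have := lipM ((1 - t) *: y, y) (conj Uty (nbhs_singleton Uy)).
  move=> /(le_trans (ler_norm _)) /= /le_trans; apply.
  rewrite (ler_pM2l M0) scalerBl scale1r addrAC subrr add0r normrN normrZ gtr0_norm//.
  by rewrite ler_pM2l//; apply: norm_le_normsq; rewrite ?yE//; exact: ltW.
have le3 : Num.sqrt (r ^+ 2 - normsq ((1 - t) *: y)) <= M * (t * r) by lra.
have : Num.sqrt (r ^+ 2 - normsq ((1 - t) *: y)) ^+ 2 <= (M * (t * r)) ^+ 2.
  by rewrite lerXn2r// nnegrE; [exact: sqrtr_ge0|exact: le_trans (sqrtr_ge0 _) le3].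
rewrite sqr_sqrtr// wE.
have -> : (M * (t * r)) ^+ 2 = r ^+ 2 * ((M ^+ 2 * t) * t) by ring.
rewrite ler_pM2l ?exprn_gt0//.
have Mtt : (M ^+ 2 * t) * t < 1 * t by rewrite ltr_pM2r.
have : t * t < 1 * t by rewrite ltr_pM2r.
by move: Mtt; rewrite expr2; lra.
Unshelve. all: by end_near. Qed.

(** The hemisphere touches [v] from below, up to a constant, at its interior
minimum, and the cap touches the hemisphere from below at the same point. *)
Lemma cap_touches_below {R : realType} (v : 'rV[R]_3 -> R) (r : R) :
  0 < r -> continuous v -> locally_lipschitz v ->
  exists y : 'rV[R]_3, exists s : R,
    [/\ 0 < s, s ^+ 2 + normsq y = r ^+ 2 &
        local_min (fun x => v x - peval (cap s y) x) y].
Proof.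
move=> r0 cv lv; have [y yr miny] := hemisphere_min v r r0 cv.
have yr' := hemisphere_min_interior v r y r0 lv yr miny.
pose s := Num.sqrt (r ^+ 2 - normsq y).
have s0 : 0 < s by rewrite sqrtr_gt0 subr_gt0.
have sE : s ^+ 2 + normsq y = r ^+ 2 by rewrite sqr_sqrtr ?subr_ge0// subrK.
exists y, s; split => //.
have : \forall z \near y, normsq z < r ^+ 2.
  exact: (cvgr_lt _ (continuous_normsq y) _ yr').
apply: filterS => z zr.
have -> : peval (cap s y) y = s by rewrite capE subrr expr0n /= !mulr0 subr0 addr0.
apply: le_trans (miny z (ltW zr)) _; rewrite lerD2l lerN2.
apply: cap_le; rewrite ?sqrtr_ge0// sE sqr_sqrtr ?subrK//.
by rewrite subr_ge0 ltW.
Qed.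

(** * Nonexistence when the curvature is bounded away from zero *)

(** The touching cap of radius [r] gives [e * k y * r < 5] through [levi_cap], so the
radius with [c * r = 5] is already too large. *)
Lemma no_entire_solution {R : realType} (e c : R) (k u : 'rV[R]_3 -> R) :
  e ^+ 2 = 1 -> 0 < c -> (forall x, c <= e * k x) ->
  locally_lipschitz u -> weak_solution u k -> False.
Proof.
move=> e1 c0 ck lu [[cu subu] [_ supu]].
have [r r0 cr] : exists2 r, 0 < r & c * r = 5.
  by exists (5 / c); [rewrite divr_gt0|rewrite mulrC divfK// gt_eqF].
have ceu : continuous (fun x => e * u x).
  by move=> x; apply: (@continuousM _ _ (cst e) u); [exact: cst_continuous|exact: cu].
have leu : locally_lipschitz (fun x => e * u x).
  move=> x; have [U Ux lip] := lu x; exists U => //.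
  move: lip; rewrite /lipschitz_on; apply: filterS => M lipM [a b] Uab /=.
  have := lipM (a, b) Uab; rewrite /= -mulrBr normrM.
  suff -> : `|e| = 1 by rewrite mul1r.
  by apply/eqP; rewrite -(@sqrp_eq1 _ `|e|)// real_normK ?num_real// e1.
have [y [s [s0 sE miny]]] := cap_touches_below _ _ r0 ceu leu.
have LE := levi_cap e s r y k s0 r0 e1 sE.
have eL : e * levi (peval (PMul (PCst e) (cap s y))) k y <= 0.
  have sm := smooth_peval (PMul (PCst e) (cap s y)).
  have me x : e * u x - peval (cap s y) x
      = e * (u x - peval (PMul (PCst e) (cap s y)) x).
    rewrite [peval (PMul _ _) x]/(e * peval (cap s y) x).
    by rewrite mulrBr (mulrA e e) -expr2 e1 mul1r.
  have : local_min (fun x => e * (u x - peval (PMul (PCst e) (cap s y)) x)) y.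
    by apply: filterS miny => z; rewrite !me.
  move: sm; set P := peval _ => sm {}miny.
  move: e1 => /eqP; rewrite sqrf_eq1 => /orP[]/eqP eE.
    rewrite eE mul1r; apply: supu => //.
    by apply: filterS miny => z; rewrite eE !mul1r.
  rewrite eE mulN1r oppr_le0; apply: subu => //.
  by apply: filterS miny => z; rewrite eE !mulN1r lerN2.
move: eL; rewrite LE mulrA pmulr_lle0 ?invr_gt0 ?exprn_gt0//.
rewrite mulrBr (mulrA e e) -expr2 e1 mul1r subr_le0 (mulrA e) => eL.
have : c * r ^+ 3 <= e * k y * r ^+ 3 by rewrite ler_pM2r ?exprn_gt0.
have -> : c * r ^+ 3 = 5 * r ^+ 2 by rewrite exprS mulrA cr.
have := sqr_ge0 (y 0 i3); have := exprn_gt0 2 s0.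
move: sE eL; rewrite /normsq.
lra.
Qed.

(** * Derivative tests at a local minimum *)

Lemma is_derive_line {R : realType} (f : 'rV[R]_3 -> R) (y v : 'rV[R]_3) (t : R) :
  derivable f (y + t *: v) v ->
  is_derive t (1 : R) (fun h => f (y + h *: v)) ('D_v f (y + t *: v)).
Proof.
have E : (fun h : R => h^-1 *: ((f \o shift (y + t *: v)) (h *: v) - f (y + t *: v)))
       = (fun h : R => h^-1 *: (((fun h => f (y + h *: v)) \o shift t) (h *: (1 : R))
                            - f (y + t *: v))).
  apply/funext => h; rewrite /= [h *: 1]mulr1 scalerDl.
  by congr (_ *: (f _ - _)); rewrite addrCA.
by move=> df; apply: DeriveDef; rewrite /derivable /derive -E.
Qed.

(** If [l] were negative, then [g'] would be negative just to the right of its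
zero [0], so [g] would decrease there by the mean value theorem. *)
Lemma derive2_ge0_at_min {R : realType} (g g' : R -> R) (l : R) :
  (forall t, is_derive t (1 : R) g (g' t)) -> is_derive (0 : R) (1 : R) g' l ->
  (\forall t \near (0 : R), g 0 <= g t) -> g' 0 = 0 /\ 0 <= l.
Proof.
move=> dg dg' /nbhs_ballP[e /= e0 me].
have gmin t : `|t| < e -> g 0 <= g t.
  by move=> te; apply: me; rewrite /ball /= sub0r normrN.
have dg0 : is_derive (0 : R) (1 : R) g 0.
  apply: (@derive1_at_min _ g (- e) e 0); first by lra.
  - by move=> t _; exact: ex_derive.
  - by rewrite in_itv /=; lra.
  - by move=> t; rewrite in_itv /= => te; apply: gmin; rewrite ltr_norml.
have g'0 : g' 0 = 0.
  by rewrite -(@derive_val _ _ _ _ _ _ _ (dg 0)) derive_val.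
split=> //; rewrite leNgt; apply/negP => l0.
have [dg'0 dl] := dg'.
have /cvgr_lt/(_ 0 l0) : h^-1 *: ((g' \o shift 0) (h *: (1 : R)) - g' 0)
    @[h --> 0^'] --> l by rewrite -dl; exact: dg'0.
rewrite near_withinE => /nbhs_ballP[d /= d0 md].
have g'lt0 h : 0 < h -> h < d -> g' h < 0.
  move=> h0 hd; have := md h; rewrite /ball /= sub0r normrN gtr0_norm//.
  move=> /(_ hd (lt0r_neq0 h0)).
  by rewrite g'0 subr0 addr0 [h *: 1]mulr1 pmulr_rlt0 ?invr_gt0.
pose h := Num.min (d / 2) (e / 2).
have h0 : 0 < h by rewrite lt_min !divr_gt0.
have hd : h < d by rewrite (@le_lt_trans _ _ (d / 2)) ?ge_min ?lexx//; lra.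
have he : h < e by rewrite (@le_lt_trans _ _ (e / 2)) ?ge_min ?lexx ?orbT//; lra.
have [|c] := @MVT _ g g' 0 h h0 (fun x _ => dg x).
  apply: continuous_subspaceT => x.
  by apply/differentiable_continuous/derivable1_diffP; exact: ex_derive.
rewrite in_itv /= => /andP[c0 ch]; rewrite subr0 => E.
have : g 0 <= g h by apply: gmin; rewrite gtr0_norm.
by rewrite -subr_ge0 E leNgt pmulr_llt0// g'lt0// (lt_trans ch).
Qed.

(** The factor [e] serves to treat minima ([e = 1]) and maxima ([e = -1])
together. *)
Lemma partial_at_local_min {R : realType} (f : 'rV[R]_3 -> R) (y : 'rV[R]_3)
    (e : R) (i : 'I_3) :
  e != 0 -> smooth f -> local_min (fun x => e * f x) y ->
  partial i f y = 0 /\ 0 <= e * partial i (partial i f) y.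
Proof.
move=> eN0 sf my; pose v : 'rV[R]_3 := delta_mx 0 i.
have y0 : y + 0 *: v = y by rewrite scale0r addr0.
have d1 t : is_derive t (1 : R) (fun t => e * f (y + t *: v))
    (e * partial i f (y + t *: v)).
  have df : is_derive t (1 : R) (fun t => f (y + t *: v)) (partial i f (y + t *: v)).
    by apply: is_derive_line; have [_] := sf [::]; exact.
  exact: (is_deriveZ e).
have d2 : is_derive (0 : R) (1 : R) (fun t => e * partial i f (y + t *: v))
    (e * partial i (partial i f) y).
  have df : is_derive (0 : R) (1 : R) (fun t => partial i f (y + t *: v))
      (partial i (partial i f) y).
    have := is_derive_line (partial i f) y v 0; rewrite y0; apply.
    by have [_] := sf [:: i]; exact.
  exact: (is_deriveZ e).
have [] := derive2_ge0_at_min _ _ _ d1 d2.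
  rewrite y0.
  have : y + t *: v @[t --> (0 : R)] --> y.
    rewrite -[X in _ --> X]y0; apply: cvgD; first exact: cvg_cst.
    by apply: cvgZr_tmp; exact: cvg_id.
  by move=> H; exact: (H _ my).
by rewrite y0 => /eqP; rewrite mulf_eq0 (negPf eN0) => /eqP.
Qed.

(** * Solutions when the curvature vanishes *)

(** Where the gradient vanishes the operator reduces to [f_11 + f_22]. *)
Lemma levi_at_extremum {R : realType} (e : R) (f k : 'rV[R]_3 -> R) (y : 'rV[R]_3) :
  e != 0 -> smooth f -> k y = 0 -> local_min (fun x => e * f x) y ->
  0 <= e * levi f k y.
Proof.
move=> e0 sf ky my.
have D i := partial_at_local_min f y e i e0 sf my.
rewrite /levi ky !(proj1 (D _)).
have := (proj2 (D i1), proj2 (D i2)).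
move: (partial i1 (partial i1 f) y) (partial i2 (partial i2 f) y) => a b [].
move=> a0 b0.
rewrite !(expr0n, mulr0, mul0r, addr0, subr0) /= mul1r mulrDr.
exact: addr_ge0.
Qed.

Lemma weak_solution0 {R : realType} (k : 'rV[R]_3 -> R) :
  (forall x, k x = 0) -> weak_solution (fun _ => 0) k.
Proof.
move=> k0; have c0 : continuous (fun _ : 'rV[R]_3 => 0 : R) by exact: cst_continuous.
split; split => // y phi sphi my.
- rewrite -[leRHS]mul1r; apply: levi_at_extremum => //.
  by apply: filterS my => z; rewrite !sub0r !mul1r lerN2.
- rewrite -oppr_ge0 -mulN1r; apply: levi_at_extremum => //.
  by apply: filterS my => z; rewrite !sub0r !mulN1r.
Qed.

Lemma locally_lipschitz_cst {R : realType} (c : R) :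
  locally_lipschitz (fun _ : 'rV[R]_3 => c).
Proof.
move=> x; exists setT; first exact: filterT.
exists 0; split=> // M M0 [a b] _ /=.
by rewrite subrr normr0; apply: mulr_ge0 => //; exact: ltW.
Qed.

(** * The conclusion *)

Lemma inf_gt0_lower_bound {R : realType} (k : 'rV[R]_3 -> R) :
  (0 < ereal_inf (range (fun x => (k x)%:E)))%E ->
  exists2 c : R, 0 < c & forall x, c <= k x.
Proof.
have kI x : (ereal_inf (range (fun x => (k x)%:E)) <= (k x)%:E)%E.
  by apply: ereal_inf_lbound; exists x.
case: ereal_inf kI => [c| |] kI //.
- by rewrite lte_fin => c0; exists c => // x; rewrite -lee_fin.
- by have := kI 0; rewrite leye_eq.
Qed.

Lemma sup_lt0_upper_bound {R : realType} (k : 'rV[R]_3 -> R) :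
  (ereal_sup (range (fun x => (k x)%:E)) < 0)%E ->
  exists2 c : R, 0 < c & forall x, c <= - k x.
Proof.
have kI x : ((k x)%:E <= ereal_sup (range (fun x => (k x)%:E)))%E.
  by apply: ereal_sup_ubound; exists x.
case: ereal_sup kI => [c| |] kI //.
- rewrite lte_fin => c0; exists (- c); first by rewrite oppr_gt0.
  by move=> x; rewrite lerN2 -lee_fin.
- by have := kI 0; rewrite leeNy_eq.
Qed.

Theorem corollary3p9 (R : realType) (k : 'rV[R]_3 -> R) (k_cont : continuous k) :
  ((0 < ereal_inf (range (fun x : 'rV[R]_3 => (k x)%:E)))%E \/
   (ereal_sup (range (fun x : 'rV[R]_3 => (k x)%:E)) < 0)%E ->
   ~ (exists u : 'rV[R]_3 -> R, locally_lipschitz u /\ weak_solution u k)) /\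
  ((exists c : R, forall x : 'rV[R]_3, k x = c) ->
   ((exists u : 'rV[R]_3 -> R, locally_lipschitz u /\ weak_solution u k) <->
    (forall x : 'rV[R]_3, k x = 0))).
Proof.
split=> [[/inf_gt0_lower_bound|/sup_lt0_upper_bound] [c c0 ck] [u [lu su]]|].
- by apply: (no_entire_solution 1 c k u) => // [|x]; rewrite ?expr1n ?mul1r.
- by apply: (no_entire_solution (-1) c k u) => // [|x]; rewrite ?sqrrN ?expr1n ?mulN1r.
- move=> [c kc]; split=> [[u [lu su]] x|k0]; last first.
    exists (fun=> 0); split; first exact: locally_lipschitz_cst.
    exact: weak_solution0.
  rewrite kc; have [c0|c0|//] := ltgtP c 0.
    case: (no_entire_solution (-1) (- c) k u) => // [||z].
    + by rewrite sqrrN expr1n.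
    + by rewrite oppr_gt0.
    + by rewrite kc mulN1r.
  case: (no_entire_solution 1 c k u) => // [|z]; first by rewrite expr1n.
  by rewrite kc mul1r.
Qed.
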